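(* Let $\mathcal B\subset\mathbb N$ and let $\varepsilon$ be a real number with $0<\varepsilon<BD^*(\mathcal B)$. Then there exist a set $\mathcal A\subset\mathbb N$ having density $D(\mathcal A)>BD^*(\mathcal B)-\varepsilon$ and strictly increasing sequences $0\leq m_1<m_2<\ldots$ and $0\leq n_1<n_2<\ldots$ in $\mathbb N$ such that $$\mathcal A\cap[0,m_j]=\{k\in[0,m_j]\ ;\ k+n_j\in\mathcal B\},\qquad j\geq 1,$$ that is, $k\in\mathcal A\Leftrightarrow k+n_j\in\mathcal B$ whenever $k\in\mathbb N$, $0\leq k\leq m_j$, $j\geq 1$.
   Context: $\mathbb N=\{0,1,2,\ldots\}$, and intervals such as $[0,m]$ are understood as intervals of integers. The upper Banach density of $\mathcal B\subset\mathbb N$ is $$BD^*(\mathcal B)=\limsup_{a,b\in\mathbb N,\ b-a\to\infty}\frac 1{b-a+1}\,\mathrm{card}(\mathcal B\cap[a,b]).$$ A set $\mathcal A\subset\mathbb N$ has density $D(\mathcal A)$ if the limit $D(\mathcal A)=\lim_{n\to\infty}\frac 1{n+1}\,\mathrm{card}(\mathcal A\cap[0,n])$ exists. *)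

(* Defs.v *)
From HB Require Import structures.
From mathcomp Require Import all_boot all_order all_algebra finmap.
From mathcomp Require Import all_classical all_reals all_analysis.

Set Implicit Arguments.
Unset Strict Implicit.
Unset Printing Implicit Defensive.

Import Order.TTheory GRing.Theory Num.Theory.
Import numFieldNormedType.Exports.

Local Open Scope classical_set_scope.
Local Open Scope ring_scope.

(* [a, b] is an interval of natural numbers, hence finite, so that [fset_set]
   does not take its default value here. For b < a the set is empty. *)
Definition card_in (B : set nat) (a b : nat) : nat :=
  #|` fset_set (B `&` `[a, b])|.

Definition frequency (R : realType) (B : set nat) (a b : nat) : R :=
  (card_in B a b)%:R / (b - a + 1)%:R.

(* The filter "b - a --> +oo" on pairs (a, b); the basic set of index N is
   { (a, b) | N <= b - a in the integers }, so in particular a <= b on it and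
   the truncated subtraction in [frequency] is harmless. *)
Definition length_pinfty : set_system (nat * nat) :=
  filter_from setT (fun N => [set ab | (ab.1 + N <= ab.2)%N]).

Definition upper_banach_density (R : realType) (B : set nat) : \bar R :=
  limf_esup (fun ab : nat * nat => (frequency R B ab.1 ab.2)%:E) length_pinfty.

Definition has_density (R : realType) (A : set nat) (d : R) : Prop :=
  frequency R A 0 n @[n --> \oo] --> d.

(* Main.v *)
Require Import Defs.
From HB Require Import structures.
From mathcomp Require Import all_boot all_order all_algebra finmap.
From mathcomp Require Import all_classical all_reals all_analysis.
From mathcomp Require Import lra zify.
Import Order.TTheory GRing.Theory Num.Theory.
Import numFieldNormedType.Exports.
Local Open Scope classical_set_scope.
Local Open Scope ring_scope.

(** Write [d] for the upper Banach density. A stopping-time argument shows that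
    for every [e > 0] there are arbitrarily far positions [p] such that each
    window [p, p + k) with [0 < k <= N] contains at least [(d - e) k] elements
    of [B]: otherwise, far out, [B] could be tiled by short windows of frequency
    below [d - e], contradicting the definition of [d]. A limit, along an
    ultrafilter, of the translates of [B] to such positions (with [e --> 0] and
    [N --> oo]) is a set [A] with at least [d k] elements in each [0, k). Since
    every initial segment of [A] is a translate of a window of [B], it also has
    upper density at most [d], so its density is exactly [d]. *)

(** Half-open windows, given by start and length, make concatenation additive and reduce translates
    to a shift of [iota]. *)
Definition window_count (B : set nat) (p k : nat) : nat :=
  count (fun i => `[< B i >]) (iota p k).

Lemma window_countD (B : set nat) (p k l : nat) :
  window_count B p (k + l) = (window_count B p k + window_count B (p + k) l)%N.
Proof. by rewrite /window_count iotaD count_cat. Qed.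

Lemma window_count_le (B : set nat) (p k : nat) : (window_count B p k <= k)%N.
Proof. by rewrite -[leqRHS](size_iota p) count_size. Qed.

Lemma eq_window_count (A B : set nat) (p k : nat) :
  (forall i, (i < k)%N -> A i <-> B (i + p)%N) ->
  window_count A 0 k = window_count B p k.
Proof.
move=> AB; rewrite /window_count -[p in RHS]addn0 iotaDl count_map.
apply: eq_in_count => i; rewrite mem_iota /= add0n => ik.
by apply/asbool_equiv_eq; rewrite addnC; exact: AB.
Qed.

Lemma card_inE (B : set nat) (a b : nat) :
  card_in B a b = window_count B a (b.+1 - a).
Proof.
rewrite /card_in /window_count -size_filter.
have finBab : finite_set (B `&` `[a, b]).
  apply: (@sub_finite_set _ _ `I_b.+1); last exact: finite_II.
  move=> x [_] /=; rewrite in_itv/=; lia.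
set s := [seq i <- _ | _].
have -> : fset_set (B `&` `[a, b]) = [fset x in s]%fset.
  apply/fsetP => x; rewrite in_fset_set// inE mem_filter mem_iota.
  apply/idP/idP.
    rewrite inE => -[Bx] /=; rewrite in_itv/= => /andP[ax xb].
    by apply/andP; split; [exact/asboolP|lia].
  move=> /andP[/asboolP Bx xab]; rewrite inE; split => //=.
  rewrite in_itv/=; lia.
by rewrite card_fseq undup_id// filter_uniq// iota_uniq.
Qed.

Lemma frequencyE (R : realType) (B : set nat) (a l : nat) :
  frequency R B a (a + l) = (window_count B a l.+1)%:R / l.+1%:R.
Proof.
by rewrite /frequency card_inE; congr (_%:R / _%:R); [congr window_count|]; lia.
Qed.

Lemma window_count_gt_upper_banach_density (R : realType) (B : set nat)
    (c : R) (N : nat) :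
  (c%:E < upper_banach_density R B)%E ->
  exists a L : nat, (N < L)%N /\ c * L%:R < (window_count B a L)%:R.
Proof.
move=> c_lt.
have /ereal_sup_gt[_ [[a b] /= aNb <-]] : (c%:E < ereal_sup [set
    (frequency R B ab.1 ab.2)%:E | ab in [set ab | (ab.1 + N <= ab.2)%N]])%E.
  apply: (lt_le_trans c_lt); apply: ereal_inf_lbound.
  by exists [set ab | (ab.1 + N <= ab.2)%N] => //; exists N.
have /subnKC <- : (a <= b)%N by lia.
rewrite lte_fin frequencyE ltr_pdivlMr ?ltr0n// => c_freq.
by exists a, (b - a).+1; split => //; lia.
Qed.

(** Some member of the filter has supremum below [c], and it contains a basic set. The resulting [N]
    is uniform in [a], so the bound passes to limits of translates. *)
Lemma window_count_lt_upper_banach_density (R : realType) (B : set nat)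
    (c : R) :
  (upper_banach_density R B < c%:E)%E ->
  exists N : nat, forall a L : nat, (N < L)%N ->
    (window_count B a L)%:R < c * L%:R.
Proof.
move=> /ereal_inf_lt[_ [V [N _ NV] <-] V_lt].
exists N => a [//|L] NL.
have := le_lt_trans (ereal_sup_ubound _) V_lt; move=> /(_ (frequency R B a (a + L))%:E).
rewrite lte_fin frequencyE ltr_pdivrMr ?ltr0n//; apply.
by exists (a, (a + L)%N) => //=; [apply: NV => /=; lia | rewrite frequencyE].
Qed.

(** Serves to make the density a real number in the main proof. *)
Lemma upper_banach_density_le1 (R : realType) (B : set nat) :
  (upper_banach_density R B <= 1)%E.
Proof.
rewrite leNgt; apply/negP => /(@window_count_gt_upper_banach_density R B 1 0).
move=> [a [L [_]]]; rewrite mul1r ltr_nat.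
by have := window_count_le B a L; lia.
Qed.

Lemma rate_ge0 (R : realType) (B : set nat) (c : R) (p k : nat) :
  (window_count B p k)%:R < c * k%:R -> 0 <= c.
Proof.
move=> /(le_lt_trans (ler0n _ _)); case: k => [|k]; first by rewrite mulr0 ltxx.
by rewrite pmulr_lgt0 ?ltr0n//; exact: ltW.
Qed.

(* Greedy tiling; the last, incomplete tile costs at most [N]. *)
Lemma window_count_tiling (R : realType) (B : set nat) (c : R) (M N : nat) :
  (forall p, (M <= p)%N -> exists2 k : nat, (0 < k <= N)%N &
     (window_count B p k)%:R < c * k%:R) ->
  forall L p : nat, (M <= p)%N ->
    (window_count B p L)%:R <= c * L%:R + N%:R.
Proof.
move=> sparse.
have c_ge0 : 0 <= c by have [k _ /rate_ge0] := sparse _ (leqnn M).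
elim/ltn_ind => L IH p Mp.
have [LN|NL] := leqP L N.
  apply: (@le_trans _ _ N%:R); last by rewrite lerDr mulr_ge0.
  by rewrite ler_nat (leq_trans (window_count_le _ _ _)).
have [k /andP[k0 kN] pk] := sparse _ Mp.
have -> : L = (k + (L - k))%N by lia.
rewrite window_countD !natrD mulrDr -addrA lerD ?(ltW pk)//.
by apply: IH; lia.
Qed.

Lemma exists_dense_prefixes (R : realType) (B : set nat) (d e : R) (M N : nat) :
  upper_banach_density R B = d%:E -> 0 < e ->
  exists2 p : nat, (M <= p)%N & forall k : nat, (0 < k <= N)%N ->
    (d - e) * k%:R <= (window_count B p k)%:R.
Proof.
move=> dE e0; apply: contrapT => no_p.
have sparse p : (M <= p)%N -> exists2 k : nat, (0 < k <= N)%N &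
    (window_count B p k)%:R < (d - e) * k%:R.
  move=> Mp; apply: contrapT => no_k; apply: no_p; exists p => // k kN.
  by rewrite leNgt; apply/negP => lt_k; apply: no_k; exists k.
have tiled := window_count_tiling _ _ _ _ _ sparse.
(* [K] is chosen so that [L - M > K] forces [(e / 2) * (L - M) > M + N]: the gain in rate then
   exceeds the total loss, [M] for the discarded start and [N] for the last tile. *)
pose K := Num.truncn ((M + N)%:R / (e / 2)).
have [|a [L [KL]]] := @window_count_gt_upper_banach_density R B (d - e / 2) (M + K).
  by rewrite dE lte_fin; lra.
(* Discarding the first [M] positions brings the start beyond [M], where the tiling applies,
   whatever [a] is. *)
have -> : L = (M + (L - M))%N by lia.
have aM := tiled (L - M)%N (a + M)%N (leq_addl _ _).
have cM : (window_count B a M)%:R <= M%:R :> R by rewrite ler_nat window_count_le.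
have c_ge0 : 0 <= d - e by have [k _ /rate_ge0] := sparse _ (leqnn M).
have : (M + N)%:R / (e / 2) < (L - M)%:R :> R.
  apply: lt_le_trans (truncnS_gt _) _; rewrite -/K ler_nat; lia.
rewrite ltr_pdivrMr; last lra.
rewrite window_countD !natrD.
have : 0 <= (M%:R : R) by rewrite ler0n.
nra.
Qed.

Theorem theorem4p2 (R : realType) (B : set nat) (eps : R)
    (eps_gt0 : 0 < eps) (eps_lt : (eps%:E < upper_banach_density R B)%E) :
  exists (A : set nat) (d : R) (m n : nat -> nat),
    [/\ has_density A d,
        (upper_banach_density R B - eps%:E < d%:E)%E,
        {homo m : i j / (i < j)%N},
        {homo n : i j / (i < j)%N} &
        forall j : nat,
          A `&` `[0%N, m j] = [set k | k \in `[0%N, m j] /\ B (k + n j)%N]].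
Proof.
have [d dE] : exists d : R, upper_banach_density R B = d%:E.
  have := upper_banach_density_le1 R B; move: eps_lt.
  by case: (upper_banach_density R B) => [d||]//; exists d.
(* The error [1 / (j + 1)], the prefix length [j] and the lower bound [j] on the position are all
   tied to one index. *)
have /choice[p p_dense] (j : nat) : exists q : nat, (j <= q)%N /\
    forall k : nat, (0 < k <= j)%N ->
      (d - j.+1%:R^-1) * k%:R <= (window_count B q k)%:R.
  have [|q jq qP] := @exists_dense_prefixes R B d j.+1%:R^-1 j j dE.
    by rewrite invr_gt0 ltr0n.
  by exists q.
have [U [U_ultra U_oo]] := ultraFilterLemma eventually_filter.
have U_proper : ProperFilter U := @ultra_proper _ _ U_ultra.
pose A := [set k | U [set j | B (k + p j)%N]].
have U_agree k : U [set j | A k <-> B (k + p j)%N].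
  have [Uk|Uk] := in_ultra_setVsetC [set j | B (k + p j)%N] U_ultra.
    by apply: filterS (Uk) => j /= Bj; split.
  apply: filterS (Uk) => j /= nBj; split => // Ak.
  by have [i []] := filter_ex (filterI (Ak : U _) Uk).
(* Finitely many sets of [U] and a tail meet, so on any initial segment [A] is an actual translate
   of [B], with index as large as desired. *)
have agree m J : exists j : nat, (J <= j)%N /\
    forall k : nat, (k < m)%N -> A k <-> B (k + p j)%N.
  have Um : U [set j | forall k : nat, (k < m)%N -> A k <-> B (k + p j)%N].
    elim: m => [|m IHm]; first by apply: filterS filterT.
    apply: filterS (filterI IHm (U_agree m)) => j [jm jA] k.
    by rewrite ltnS leq_eqVlt => /predU1P[->//|]; exact: jm.
  have UJ : U [set j | (J <= j)%N] by apply: U_oo; exists J.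
  by have [j [? ?]] := filter_ex (filterI UJ Um); exists j.
have A_ge k : (0 < k)%N -> d * k%:R <= (window_count A 0 k)%:R.
  move=> k0; have k0R : 0 < k%:R :> R by rewrite ltr0n.
  rewrite -ler_pdivlMr//; apply/ler_addgt0Pr => e e0.
  (* [j >= k] makes [p_dense] cover the prefix of length [k], and [j + 1 > 1 / e] makes its error at
     most [e]. *)
  have [j [Jj jA]] := agree k (k + Num.truncn e^-1)%N.
  rewrite -lerBlDr ler_pdivlMr// (eq_window_count _ _ _ _ jA).
  apply: le_trans ((p_dense j).2 k _); last by lia.
  rewrite ler_pM2r// lerD2l lerN2 invf_ple ?posrE ?ltr0n//.
  apply: ltW; apply: lt_le_trans (truncnS_gt _) _.
  by rewrite ler_nat ltnS (leq_trans (leq_addl _ _) Jj).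
have A_le e : 0 < e -> exists N : nat, forall k : nat, (N < k)%N ->
    (window_count A 0 k)%:R < (d + e) * k%:R.
  move=> e0; have [|N BN] := @window_count_lt_upper_banach_density R B (d + e).
    by rewrite dE lte_fin ltrDl.
  exists N => k Nk; have [j [_ jA]] := agree k 0%N.
  by rewrite (eq_window_count _ _ _ _ jA); exact: BN.
have /choice[f f_agree] (mb : nat * nat) : exists n : nat, (mb.2 <= n)%N /\
    forall k : nat, (k <= mb.1)%N -> A k <-> B (k + n)%N.
  have [j [bj jA]] := agree mb.1.+1 mb.2.
  by exists (p j); split => //; exact: leq_trans (p_dense j).1.
(* Requiring each shift to be at least [(n i).+1] makes [n] strictly increasing; agreement up to [j]
   at stage [j] allows [m] to be the identity. *)
pose n := fix n j := if j is i.+1 then f (i.+1, (n i).+1) else f (0, 0)%N.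
have n_agree j k : (k <= j)%N -> A k <-> B (k + n j)%N.
  by case: j => [|j]; [exact: (f_agree (0, 0)%N).2 |
                      exact: (f_agree (j.+1, (n j).+1)).2].
exists A, d, id, n; split => //.
- apply/cvgrPdist_lt => e e0.
  have [N AN] := A_le e e0.
  exists N => // k /= Nk.
  rewrite -[k]add0n frequencyE.
  have k0 : 0 < k.+1%:R :> R by rewrite ltr0n.
  (* By [A_ge] the frequency never falls below [d], so only the upper estimate [AN] remains. *)
  rewrite ler0_norm; last by rewrite subr_le0 ler_pdivlMr// A_ge.
  by rewrite opprB ltrBlDl ltr_pdivrMr// AN.
- by rewrite dE -EFinB lte_fin gtrBl.
- by apply: (homo_ltn ltn_trans) => i; exact: (f_agree (i.+1, (n i).+1)).1.
- move=> j; apply/seteqP; split => k /=; rewrite in_itv/=.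
    by move=> [Ak kj]; split => //; apply/(n_agree j).
  by move=> [kj Bk]; split => //; apply/(n_agree j).
Qed.
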